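(* There is an algorithm which, given a directed acyclic graph $G$ with $n$ vertices and $m$ arcs, a source $s$, a target $t$ and a cost matrix $Q\in\mathbb{R}^{m\times m}$ satisfying the assumptions in the context, decides in $\mathcal{O}(nm^3)$ steps (arithmetic operations) whether the quadratic shortest path problem instance is linearizable and, if it is, returns a linearization vector $c$ of $Q$.
   Context: $G=(V,A)$ is a directed acyclic graph whose vertices are topologically sorted as $v_1=s,\dots,v_n=t$ ($(v_i,v_j)\in A$ implies $i<j$), and every vertex lies on at least one $s$-$t$ path. $Q=(q_{e,f})_{e,f\in A}$ is a symmetric matrix (the interaction cost of distinct arcs $e,f$ is $2q_{e,f}$) with zero diagonal. The quadratic shortest path problem is to minimize $x^{\mathrm T}Qx$ over the set $\mathcal{P}\subseteq\{0,1\}^A$ of characteristic vectors of $s$-$t$ paths. The instance (or $Q$) is linearizable if there is $c\in\mathbb{R}^m$, called a linearization vector, with $x^{\mathrm T}Qx=c^{\mathrm T}x$ for all $x\in\mathcal{P}$. *)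

(* Defs.v *)
From mathcomp Require Import all_boot all_order all_algebra.
From mathcomp Require Import reals.

Set Implicit Arguments.
Unset Strict Implicit.
Unset Printing Implicit Defensive.

Import Order.TTheory GRing.Theory Num.Theory.
Local Open Scope ring_scope.

(** * The quadratic shortest path problem

   The vertices v_1, ..., v_(n+1) are the elements of ['I_n.+1] in topological
   order, so that s is [ord0] and t is [ord_max]; the m arcs are listed in an
   arbitrary order, which is the one that indexes Q, c and x. *)

Section Qspp.
Variables (n m : nat) (arcs : m.-tuple ('I_n.+1 * 'I_n.+1)).

(* The path visits the vertices s :: p.  No vertex can be repeated when the
   graph is topologically sorted. *)
Definition st_path (p : seq 'I_n.+1) : bool :=
  path (fun u v => (u, v) \in arcs) ord0 p && (last ord0 p == ord_max).

Record st_dag : Prop := StDag {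
  st_dag_uniq : uniq arcs;
  st_dag_sorted : forall u v : 'I_n.+1, (u, v) \in arcs -> (u < v)%N;
  st_dag_cover : forall v : 'I_n.+1,
    exists p : seq 'I_n.+1, st_path p /\ v \in ord0 :: p }.

Variable R : realType.

(* [zip (ord0 :: p) p] lists the pairs of consecutive vertices of s :: p. *)
Definition char_vec (p : seq 'I_n.+1) : 'cV[R]_m :=
  \col_e (tnth arcs e \in zip (ord0 :: p) p)%:R.

Definition feasible (x : 'cV[R]_m) : Prop :=
  exists p : seq 'I_n.+1, st_path p /\ x = char_vec p.

Definition cost_matrix (Q : 'M[R]_m) : Prop :=
  Q^T = Q /\ forall e : 'I_m, Q e e = 0.

Definition linearization_vector (Q : 'M[R]_m) (c : 'cV[R]_m) : Prop :=
  forall x : 'cV[R]_m, feasible x -> x^T *m Q *m x = c^T *m x.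

Definition linearizable (Q : 'M[R]_m) : Prop :=
  exists c : 'cV[R]_m, linearization_vector Q c.

End Qspp.

(** * Real RAM programs

   Memory consists of finitely many (per program) two-dimensional arrays of
   natural numbers and of real numbers; a scalar variable is the cell (0, 0) of
   an array.  The name of an array is a constant of the program, whereas the
   indices are computed.  Natural numbers, which serve as indices, can only be
   added, subtracted (with truncation) and compared: there is no unit-cost
   multiplication of integers.  Real numbers can be added, subtracted,
   multiplied, divided and compared; there are no real constants other than the
   natural numbers, and no way to turn a real number into an index. *)

Inductive nexp : Type :=
| NConst of nat
| NGet of nat & nexp & nexp       (* array, row, column *)
| NAdd of nexp & nexp
| NSub of nexp & nexp.

Inductive rexp : Type :=
| RConst of nat
| RGet of nat & nexp & nexp
| RAdd of rexp & rexp
| RSub of rexp & rexp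
| RMul of rexp & rexp
| RDiv of rexp & rexp.

Inductive bexp : Type :=
| BNLe of nexp & nexp
| BRLe of rexp & rexp
| BNot of bexp
| BAnd of bexp & bexp.

Inductive cmd : Type :=
| Skip
| NSet of nat & nexp & nexp & nexp  (* array, row, column, new value *)
| RSet of nat & nexp & nexp & rexp
| Seq of cmd & cmd
| If of bexp & cmd & cmd
| While of bexp & cmd.

Definition memory (T : Type) := nat -> nat -> nat -> T.

Definition upd (T : Type) (mem : memory T) (a i j : nat) (x : T) : memory T :=
  fun a' i' j' =>
    if [&& a' == a, i' == i & j' == j] then x else mem a' i' j'.

Record state (R : Type) := State { nmem : memory nat; rmem : memory R }.

Section Semantics.
Variable R : realType.

Fixpoint neval (st : state R) (e : nexp) : nat :=
  match e with
  | NConst k => k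
  | NGet a i j => nmem st a (neval st i) (neval st j)
  | NAdd e1 e2 => (neval st e1 + neval st e2)%N
  | NSub e1 e2 => (neval st e1 - neval st e2)%N
  end.

Fixpoint reval (st : state R) (e : rexp) : R :=
  match e with
  | RConst k => k%:R
  | RGet a i j => rmem st a (neval st i) (neval st j)
  | RAdd e1 e2 => reval st e1 + reval st e2
  | RSub e1 e2 => reval st e1 - reval st e2
  | RMul e1 e2 => reval st e1 * reval st e2
  | RDiv e1 e2 => reval st e1 / reval st e2
  end.

Fixpoint beval (st : state R) (b : bexp) : bool :=
  match b with
  | BNLe e1 e2 => (neval st e1 <= neval st e2)%N
  | BRLe e1 e2 => reval st e1 <= reval st e2
  | BNot b1 => ~~ beval st b1
  | BAnd b1 b2 => beval st b1 && beval st b2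
  end.

(* Every constant, memory access and operation takes one step, whether it acts
   on indices or on real numbers. *)
Fixpoint ncost (e : nexp) : nat :=
  match e with
  | NConst _ => 1
  | NGet _ i j => (ncost i + ncost j).+1
  | NAdd e1 e2 | NSub e1 e2 => (ncost e1 + ncost e2).+1
  end.

Fixpoint rcost (e : rexp) : nat :=
  match e with
  | RConst _ => 1
  | RGet _ i j => (ncost i + ncost j).+1
  | RAdd e1 e2 | RSub e1 e2 | RMul e1 e2 | RDiv e1 e2 =>
      (rcost e1 + rcost e2).+1
  end.

Fixpoint bcost (b : bexp) : nat :=
  match b with
  | BNLe e1 e2 => (ncost e1 + ncost e2).+1
  | BRLe e1 e2 => (rcost e1 + rcost e2).+1
  | BNot b1 => (bcost b1).+1
  | BAnd b1 b2 => (bcost b1 + bcost b2).+1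
  end.

(* [exec p st k st']: started in state st, the program p halts after exactly k
   steps in state st'. *)
Inductive exec : cmd -> state R -> nat -> state R -> Prop :=
| ExecSkip st : exec Skip st 1 st
| ExecNSet st a i j e :
    exec (NSet a i j e) st (ncost i + ncost j + ncost e).+1
      (State (upd (nmem st) a (neval st i) (neval st j) (neval st e)) (rmem st))
| ExecRSet st a i j e :
    exec (RSet a i j e) st (ncost i + ncost j + rcost e).+1
      (State (nmem st) (upd (rmem st) a (neval st i) (neval st j) (reval st e)))
| ExecSeq p1 p2 st st1 st2 k1 k2 :
    exec p1 st k1 st1 -> exec p2 st1 k2 st2 ->
    exec (Seq p1 p2) st (k1 + k2) st2
| ExecIf b p1 p2 st st1 k :
    exec (if beval st b then p1 else p2) st k st1 ->
    exec (If b p1 p2) st (bcost b + k).+1 st1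
| ExecWhileFalse b p st :
    ~~ beval st b -> exec (While b p) st (bcost b).+1 st
| ExecWhileTrue b p st st1 st2 k1 k2 :
    beval st b -> exec p st k1 st1 -> exec (While b p) st1 k2 st2 ->
    exec (While b p) st (bcost b + k1 + k2).+1 st2.

Lemma exec_det p st k1 st1 k2 st2 :
  exec p st k1 st1 -> exec p st k2 st2 -> k1 = k2 /\ st1 = st2.
Proof.
move=> H; elim: H k2 st2 => {p st k1 st1}.
- by move=> st k st' H; inversion H.
- by move=> st a i j e k st' H; inversion H.
- by move=> st a i j e k st' H; inversion H.
- move=> p1 p2 st st1 st2 k1 k2 _ IH1 _ IH2 k st' H; inversion H; subst.
  have [-> ?] := IH1 _ _ ltac:(eassumption); subst.
  by have [-> ->] := IH2 _ _ ltac:(eassumption).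
- move=> b p1 p2 st st1 k _ IH k' st' H; inversion H; subst.
  by have [-> ->] := IH _ _ ltac:(eassumption).
- by move=> b p st /negP nb k' st' H; inversion H.
- move=> b p st st1 st2 k1 k2 tb _ IH1 _ IH2 k' st' H.
  inversion H; subst; first by exfalso; apply: (elimN idP _ tb).
  have [-> ?] := IH1 _ _ ltac:(eassumption); subst.
  by have [-> ->] := IH2 _ _ ltac:(eassumption).
Qed.

(** * Input and output conventions *)

Variables (n m : nat).

(* Arrays of naturals: 0 holds the number of vertices, 1 the number of arcs, and
   2 and 3 the tails and the heads of the arcs.  Array 0 of reals holds Q.  All
   the other cells are 0. *)
Definition input_state (arcs : m.-tuple ('I_n.+1 * 'I_n.+1)) (Q : 'M[R]_m) :
    state R :=
  State
    (fun a i j => match a, j with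
       | 0, 0 => if i == 0 then n.+1 else 0
       | 1, 0 => if i == 0 then m else 0
       | 2, 0 => nth 0 [seq val uv.1 | uv <- arcs] i
       | 3, 0 => nth 0 [seq val uv.2 | uv <- arcs] i
       | _, _ => 0
       end)%N
    (fun a i j => match a, insub i, insub j with
       | 0%N, Some e, Some f => Q e f
       | _, _, _ => 0
       end).

(* The answer is the cell (0, 0) of array 4 of naturals (1 for yes, 0 for no),
   and the returned vector is column 0 of array 1 of reals. *)
Definition output_answer (st : state R) : nat := nmem st 4 0 0.

Definition output_vector (st : state R) : 'cV[R]_m :=
  \col_e rmem st 1 (val e) 0.

End Semantics.

(* Main.v *)
Require Import Defs.
From mathcomp Require Import all_boot all_order all_algebra.
From mathcomp Require Import boolp reals.
From mathcomp Require Import zify ring lra.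

(* Fix for every vertex v a path A_v from s to v and a path B_v from v to t,
   and put f(x) = x^T Q x.  For arcs e = (a,b) and g = (p,q) such that p is
   reachable from b, let
     H(e,g) = (e + A_a - A_b)^T Q (g + B_q - B_p).
   Comparing the four s-t paths that pass through A_a e or A_b, then through a
   path from b to p, and then through g B_q or B_p shows that H(e,g) = 0 if Q is
   linearizable.  Conversely, let H vanish on all these pairs and let P be a
   path from s to u.  Since P - A_u telescopes to the sum of the e + A_a - A_b
   over the arcs e of P, replacing P by A_u does not change
     f(P g B_q) - f(P B_p)   for g = (p,q), p = u,
   so that c(g) = f(A_p g B_q) - f(A_p B_p), where the subtracted term is
   omitted if p = s, is a linearization vector.

   The algorithm computes c and the sum of the H(e,g)^2 weighted by numbers of
   paths from b to p, in a sequence of tables T[i][j] = sum_k E(i,j,k), each of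
   which takes O(nm^2 + m^3) steps. *)

Set Implicit Arguments.
Unset Strict Implicit.
Unset Printing Implicit Defensive.

Import Order.TTheory GRing.Theory Num.Theory.
Local Open Scope ring_scope.

(** * Running times of loops *)

Lemma upd_same (T : Type) (mem : memory T) a i j x : upd mem a i j x a i j = x.
Proof. by rewrite /upd !eqxx. Qed.

Lemma upd_neq (T : Type) (mem : memory T) a i j x a' i' j' :
  a' != a -> upd mem a i j x a' i' j' = mem a' i' j'.
Proof. by rewrite /upd => /negPf->. Qed.

Lemma upd_upd (T : Type) (mem : memory T) a i j x y :
  upd (upd mem a i j x) a i j y = upd mem a i j y.
Proof.
by apply/funext=> a'; apply/funext=> i'; apply/funext=> j'; rewrite /upd; case: ifP => // ->.
Qed.

Lemma updC (T : Type) (mem : memory T) a b i j i' j' x y : a != b ->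
  upd (upd mem a i j x) b i' j' y = upd (upd mem b i' j' y) a i j x.
Proof.
move=> ab; apply/funext=> a1; apply/funext=> i1; apply/funext=> j1; rewrite /upd.
by case: (eqVneq a1 b) ab => //= ->; rewrite eq_sym => /negPf->.
Qed.

Definition cell0 (a : nat) : nexp := NGet a (NConst 0) (NConst 0).

Definition for_loop (a : nat) (bound : nexp) (body : cmd) : cmd :=
  Seq (NSet a (NConst 0) (NConst 0) (NConst 0))
    (While (BNot (BNLe bound (cell0 a)))
       (Seq body (NSet a (NConst 0) (NConst 0) (NAdd (cell0 a) (NConst 1))))).

(** Rows are filled in increasing order, so that [e] may read earlier rows of [t] itself; cell 7
    counts the terms of the sum. *)
Definition table (t : nat) (rows cols terms : nexp) (e : rexp) : cmd :=
  for_loop 5 rows (for_loop 6 cols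
    (Seq (RSet t (cell0 5) (cell0 6) (RConst 0))
       (for_loop 7 terms
          (RSet t (cell0 5) (cell0 6)
             (RAdd (RGet t (cell0 5) (cell0 6)) e))))).

Definition table_cost (rows cols terms : nexp) (e : rexp) : nat :=
  (ncost rows + ncost cols + ncost terms + rcost e + 90)%N.

Section Loops.
Variable R : realType.

Definition halts (p : cmd) (st : state R) (B : nat) (Post : state R -> Prop) :=
  exists k st', [/\ exec p st k st', (k <= B)%N & Post st'].

Lemma halts_seq p q st B B' (P S : state R -> Prop) :
  halts p st B P -> (forall st', P st' -> halts q st' B' S) ->
  halts (Seq p q) st (B + B') S.
Proof.
move=> [k [st1 [ep lk /[swap]]]] /[apply] -[k' [st2 [eq lk' S2]]].
by exists (k + k')%N, st2; split=> //; [exact: ExecSeq ep eq | exact: leq_add].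
Qed.

Lemma halts_weaken p st b b' (P P' : state R -> Prop) :
  halts p st b P -> (b <= b')%N -> (forall st', P st' -> P' st') -> halts p st b' P'.
Proof.
move=> [k [st' [ex lk Pst']]] lb PP'; exists k, st'; split=> //.
  exact: leq_trans lk lb.
exact: PP'.
Qed.

Definition set_cell0 (a : nat) (st : state R) (v : nat) : state R :=
  State (upd (nmem st) a 0 0 v) (rmem st).

(** [Inv i] describes the state at the loop test when the counter is [i]. The constant 20 covers the
    test and the increment of each round and the initial assignment. *)
Lemma for_loop_halts a bound body N B (Inv : nat -> state R -> Prop) st :
  (forall i st', Inv i st' -> neval st' bound = N /\ nmem st' a 0 0 = i) ->
  (forall i st', (i < N)%N -> Inv i st' ->
     halts body st' B (fun st2 => nmem st2 a 0 0 = i /\ Inv i.+1 (set_cell0 a st2 i.+1))) ->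
  Inv 0%N (set_cell0 a st 0) ->
  halts (for_loop a bound body) st ((B + ncost bound + 20) * N.+1) (Inv N).
Proof.
move=> Hinv Hbody H0.
(* Induction on the number [d] of remaining rounds; of the 14 extra steps per round, 6 belong to the
   test and 8 to the increment. *)
suff loop d i st' : (i + d = N)%N -> Inv i st' ->
    halts (While (BNot (BNLe bound (cell0 a)))
       (Seq body (NSet a (NConst 0) (NConst 0) (NAdd (cell0 a) (NConst 1)))))
       st' ((B + ncost bound + 14) * d + (ncost bound + 6)) (Inv N).
  have [k [st2 [ek lk I2]]] := loop N 0%N _ (add0n N) H0.
  exists (4 + k)%N, st2; split=> //; last first.
    apply: leq_trans (_ : 4 + _ <= _)%N; first by rewrite leq_add2l; exact: lk.
    by rewrite mulnSr; nia.
  by apply: ExecSeq ek; exact: ExecNSet.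
elim: d i st' => [|d IH] i st' => [/[!addn0] -> I|dN I].
  have [eN ea] := Hinv _ _ I.
  exists (ncost bound + 6)%N, st'; split=> //; last by lia.
  have -> : (ncost bound + 6 =
     (bcost (BNot (BNLe bound (cell0 a)))).+1)%N by rewrite /=; lia.
  by apply: ExecWhileFalse; rewrite /= eN ea leqnn.
have [eN ea] := Hinv _ _ I.
have iN : (i < N)%N by lia.
have [k [st2 [ek lk [e2 I2]]]] := Hbody _ _ iN I.
have [|k' [st3 [ek' lk' I3]]] := IH _ _ _ I2; first by lia.
exists (bcost (BNot (BNLe bound (cell0 a))) + (k + 8) + k').+1, st3; split=> //.
  apply: ExecWhileTrue ek'; first by rewrite /= eN ea -ltnNge.
  apply: ExecSeq ek _.
  by have := ExecNSet st2 a (NConst 0) (NConst 0) (NAdd (cell0 a) (NConst 1));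
    rewrite /= e2 (addn1 i).
by rewrite /= mulnSr; lia.
Qed.

Definition set_array (rm : memory R) (t : nat) (T : nat -> nat -> R) : memory R :=
  fun a => if a == t then T else rm a.

Lemma upd_set_array rm t T i j x :
  upd (set_array rm t T) t i j x =
  set_array rm t (fun i' j' => if (i' == i) && (j' == j) then x else T i' j').
Proof.
apply/funext=> a; apply/funext=> i'; apply/funext=> j'; rewrite /upd /set_array.
by case: (a == t).
Qed.

(** * Filling a table by three nested loops *)

Variable nm : memory nat.

(** While tables are computed, the natural memory differs from [nm] only in the three loop
    counters. *)
Definition counters (rm : memory R) (i j k : nat) : state R :=
  State (upd (upd (upd nm 5 0 0 i) 6 0 0 j) 7 0 0 k) rm.

Lemma set_cell05 rm i j k v : set_cell0 5 (counters rm i j k) v = counters rm v j k.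
Proof. by rewrite /set_cell0 /counters /= (@updC _ _ 7 5) // (@updC _ _ 6 5) // upd_upd. Qed.

Lemma set_cell06 rm i j k v : set_cell0 6 (counters rm i j k) v = counters rm i v k.
Proof. by rewrite /set_cell0 /counters /= (@updC _ _ 7 6) // upd_upd. Qed.

Lemma set_cell07 rm i j k v : set_cell0 7 (counters rm i j k) v = counters rm i j v.
Proof. by rewrite /set_cell0 /counters /= upd_upd. Qed.

(** By the locality hypothesis, [e] depends on [t] only through rows above the current one. Later
    writes therefore do not change the sum that defines a finished cell, and the final [T] solves a
    recurrence with [T] itself on the right. *)
Lemma table_halts t rows cols terms e N M K rm i0 j0 k0 :
  (forall rm i j k, neval (counters rm i j k) rows = N) ->
  (forall rm i j k, neval (counters rm i j k) cols = M) ->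
  (forall rm i j k, neval (counters rm i j k) terms = K) ->
  (forall T T' i j k, (i < N)%N -> (j < M)%N -> (k < K)%N ->
     (forall i' j', (i' < i)%N -> (j' < M)%N -> T i' j' = T' i' j') ->
     reval (counters (set_array rm t T) i j k) e =
     reval (counters (set_array rm t T') i j k) e) ->
  halts (table t rows cols terms e) (counters rm i0 j0 k0)
    (table_cost rows cols terms e * (N.+1 * M.+1 * K.+1))
    (fun st => exists i j k T, st = counters (set_array rm t T) i j k /\
       forall i j, (i < N)%N -> (j < M)%N ->
       T i j = \sum_(k < K) reval (counters (set_array rm t T) i j k) e).
Proof.
move=> eN eM eK loc.
pose entry T i j := \sum_(k < K) reval (counters (set_array rm t T) i j k) e.
pose add_term := RSet t (cell0 5) (cell0 6) (RAdd (RGet t (cell0 5) (cell0 6)) e).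
pose cell_body := Seq (RSet t (cell0 5) (cell0 6) (RConst 0)) (for_loop 7 terms add_term).
pose row_body := for_loop 6 cols cell_body.
pose BK := ((rcost e + 15 + ncost terms + 20) * K.+1)%N.
pose BM := ((8 + BK + ncost cols + 20) * M.+1)%N.
have entry_loc T T' i j : (i < N)%N -> (j < M)%N ->
    (forall i' j', (i' < i)%N -> (j' < M)%N -> T i' j' = T' i' j') ->
    entry T i j = entry T' i j.
  by move=> iN jM TT'; apply: eq_bigr => k _; exact: loc.
pose ok T i j := T i j = entry T i j.
pose Inv i st := exists T j k, st = counters (set_array rm t T) i j k /\
  forall i' j', (i' < i)%N -> (i' < N)%N -> (j' < M)%N -> ok T i' j'.
have [|||k [st [ex lk [T [j [k' [Est H]]]]]]] :=
    @for_loop_halts 5 rows row_body N BM Inv (counters rm i0 j0 k0) _ _ _.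
- by move=> i st [T [j [k [-> _]]]]; rewrite eN /counters /= upd_neq // upd_neq // upd_same.
- move=> i _ iN [T0 [j0' [k0' [-> H0]]]].
  pose InvJ j st := exists T k, [/\ st = counters (set_array rm t T) i j k,
    forall i' j', (i' < i)%N -> (j' < M)%N -> T i' j' = T0 i' j' &
    forall j', (j' < j)%N -> (j' < M)%N -> ok T i j'].
  have [|||k [st [ex lk [T [k' [Est TT0 H]]]]]] :=
    @for_loop_halts 6 cols cell_body M (8 + BK) InvJ
       (counters (set_array rm t T0) i j0' k0') _ _ _.
  + by move=> j st [T [k [-> _ _]]]; rewrite eM /counters /= upd_neq // upd_same.
  + move=> j _ jM [T [k1 [-> TT0 Hj]]].
    (* The table after [k] rounds of the innermost loop: the current cell holds a partial sum,
       evaluated with the table [T] from before the cell was reset. *)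
    pose Tk k i' j' := if (i' == i) && (j' == j) then
      \sum_(k' < K | (k' < k)%N) reval (counters (set_array rm t T) i j k') e
      else T i' j'.
    pose InvK k st := st = counters (set_array rm t (Tk k)) i j k.
    apply: (halts_seq (P := eq (counters (set_array rm t (Tk 0%N)) i j k1))).
      exists 8%N, (counters (set_array rm t (Tk 0%N)) i j k1); split.
      * have := ExecRSet (counters (set_array rm t T) i j k1) t (cell0 5) (cell0 6) (RConst 0).
        rewrite /= upd_set_array; congr exec; congr (State _ (set_array _ _ _)).
        apply/funext=> i'; apply/funext=> j'; rewrite /Tk /=.
        by case: ifP => // _; rewrite big_pred0.
      * by [].
      * by [].
    move=> _ <-.
    have [|||k2 [st2 [ex2 lk2 Est2]]] := @for_loop_halts 7 terms add_term K (rcost e + 15) InvK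
             (counters (set_array rm t (Tk 0%N)) i j k1) _ _ _.
    * by move=> k st ->; rewrite eK /counters /= upd_same.
    * move=> k _ kK ->.
      exists (rcost e + 15)%N, (counters (set_array rm t (Tk k.+1)) i j k).
      split=> //; last by rewrite set_cell07 /counters /= upd_same.
      have := ExecRSet (counters (set_array rm t (Tk k)) i j k) t (cell0 5) (cell0 6)
        (RAdd (RGet t (cell0 5) (cell0 6)) e).
      rewrite [X in exec _ _ X _](_ : _ = rcost e + 15)%N; last by rewrite /=; lia.
      rewrite /= upd_set_array; congr exec; congr (State _ (set_array _ _ _)).
      apply/funext=> i'; apply/funext=> j'.
      rewrite [RHS]/Tk; case E: ((i' == i) && (j' == j)); last by rewrite /Tk E.
      rewrite {1}/set_array eqxx [in X in X + _]/Tk !eqxx /=.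
      rewrite [RHS](bigD1 (Ordinal kK)) //= addrC; congr (_ + _); last first.
        (* The partial sum sits in row [i], on which [e] does not depend. *)
        apply: (loc (Tk k)) => // i2 j2 ii _.
        by rewrite /Tk (ltn_eqF ii).
      by apply: eq_bigl => k'; rewrite -val_eqE /=; lia.
    * by rewrite set_cell07.
    rewrite {}Est2 in ex2.
    exists k2, (counters (set_array rm t (Tk K)) i j K); split=> //.
    split; first by rewrite /counters /= upd_neq // upd_same.
    rewrite set_cell06; exists (Tk K), K; split=> //.
      by move=> i' j' ii jj; rewrite -TT0 // /Tk (ltn_eqF ii).
    have TkT i' j' : (i' < i)%N -> (j' < M)%N -> Tk K i' j' = T i' j'.
      by move=> ii _; rewrite /Tk (ltn_eqF ii).
    move=> j' jj j'M; rewrite /ok (entry_loc _ T) // /Tk eqxx /=.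
    have [-> |nj] := eqVneq j' j; first by apply: eq_bigl => k'; rewrite ltn_ord.
    by apply: Hj => //; move: nj jj; rewrite ltnS leq_eqVlt => /negPf->.
  + by rewrite set_cell06; exists T0, k0'; split.
  rewrite {}Est in ex.
  exists k, (counters (set_array rm t T) i M k'); split=> //.
  split; first by rewrite /counters /= upd_neq // upd_neq // upd_same.
  rewrite set_cell05; exists T, M, k'; split=> // i' j'.
  rewrite ltnS leq_eqVlt => /predU1P[-> _ jM|ii i'N jM]; first exact: H.
  rewrite /ok TT0 // H0 //; apply: entry_loc => // i2 j2 i2i j2M.
  by rewrite TT0 //; exact: ltn_trans ii.
- rewrite set_cell05; exists (rm t), j0, k0; split=> //.
  by congr counters; apply/funext=> a; rewrite /set_array; case: eqP => [->|].
rewrite {}Est in ex.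
exists k, (counters (set_array rm t T) N j k'); split=> //; last first.
  exists N, j, k', T; split=> // i1 j1 i1N j1M; exact: H.
apply: leq_trans lk _; rewrite /BM /BK /table_cost.
set a := ncost rows; set b := ncost cols; set c := ncost terms; set d := rcost e.
rewrite !mulnA -[X in (_ <= X)%N]mulnA mulnAC -[X in (_ <= X)%N]mulnA.
clear; nia.
Qed.

End Loops.

(** * Linearizability and reference paths *)

Section Walks.
Variables (n m : nat) (arcs : m.-tuple ('I_n.+1 * 'I_n.+1)).
Hypothesis dag : st_dag arcs.

Definition arc_tail (e : 'I_m) : 'I_n.+1 := (tnth arcs e).1.
Definition arc_head (e : 'I_m) : 'I_n.+1 := (tnth arcs e).2.

Lemma arc_tail_lt_head e : (arc_tail e < arc_head e)%N.
Proof. by apply: st_dag_sorted dag _ _ _; rewrite -surjective_pairing mem_tnth. Qed.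

(** Walks are sequences of arc indices, because [Q] and the vectors are indexed by arcs. *)
Fixpoint walk (u : 'I_n.+1) (r : seq 'I_m) (v : 'I_n.+1) : bool :=
  if r is e :: r' then (arc_tail e == u) && walk (arc_head e) r' v else u == v.

Lemma walk_cat u r1 v r2 w : walk u r1 v -> walk v r2 w -> walk u (r1 ++ r2) w.
Proof. by elim: r1 u => [|e r IH] u /= => [/eqP-> //|/andP[-> /IH]]. Qed.

Lemma walk_catP u r1 r2 w :
  walk u (r1 ++ r2) w -> exists v, walk u r1 v /\ walk v r2 w.
Proof.
elim: r1 u => [|e r IH] u /= => [|/andP[-> /IH//]].
by exists u.
Qed.

Lemma walk_rcons u r e v : walk u (rcons r e) v = walk u r (arc_tail e) && (arc_head e == v).
Proof.
elim: r u => [|f r IH] u /=; first by rewrite eq_sym.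
by rewrite IH andbA.
Qed.

Lemma walk_leq u r v : walk u r v -> (u <= v)%N.
Proof.
elim: r u => [|e r IH] u /= => [/eqP->//|/andP[/eqP<- /IH]].
by move=> /(leq_trans _); apply; rewrite ltnW // arc_tail_lt_head.
Qed.

Lemma walk_loop u r : walk u r u -> r = [::].
Proof.
case: r => //= e r /andP[/eqP <- /walk_leq].
by rewrite leqNgt arc_tail_lt_head.
Qed.

Lemma walk_tail_geq u r v e : walk u r v -> e \in r -> (u <= arc_tail e)%N.
Proof.
elim: r u => [|f r IH] u //= /andP[/eqP<- w]; rewrite inE => /predU1P[->//|er].
by apply: leq_trans (IH _ w er); rewrite ltnW // arc_tail_lt_head.
Qed.

(** Tails increase strictly along a walk, so no arc recurs. *)
Lemma walk_uniq u r v : walk u r v -> uniq r.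
Proof.
elim: r u => [|e r IH] u //= /andP[_ w]; rewrite (IH _ w) andbT.
by apply/negP => /(walk_tail_geq w); rewrite leqNgt arc_tail_lt_head.
Qed.

Lemma walk_reach u r v e : walk u r v -> e \in r -> exists r', walk (arc_head e) r' v.
Proof.
move=> w /path.splitPr E; case: E w => r1 r2 /walk_catP[x [_ /= /andP[_ w]]].
by exists r2.
Qed.

Lemma arc_index u v : (u, v) \in arcs -> exists e, arc_tail e = u /\ arc_head e = v.
Proof. by move=> /tnthP[e E]; exists e; rewrite /arc_tail /arc_head -E. Qed.

(** The arc list has no repetitions, so each pair of consecutive vertices determines one arc
    index. *)
Lemma path_walk u p : path (fun x y => (x, y) \in arcs) u p ->
  exists r, walk u r (last u p) /\
    forall e, (tnth arcs e \in zip (u :: p) p) = (e \in r).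
Proof.
elim: p u => [|v p IH] u /=; first by exists [::]; split=> //= e.
move=> /andP[/arc_index[e [te he]] /IH[r [w wE]]].
exists (e :: r); split; first by rewrite /= te eqxx he.
move=> f; rewrite /= !inE wE; congr (_ || _).
have -> : (u, v) = tnth arcs e by rewrite -te -he -surjective_pairing.
apply/eqP/eqP => [|->//] E; exact: (elimT (tuple_uniqP arcs) (st_dag_uniq dag)).
Qed.

Lemma walk_path u r v : walk u r v ->
  exists p, [/\ path (fun x y => (x, y) \in arcs) u p, last u p = v &
    forall e, (tnth arcs e \in zip (u :: p) p) = (e \in r)].
Proof.
elim: r u => [|f r IH] u /=; first by move=> /eqP->; exists [::].
move=> /andP[/eqP<- /IH[p [pp lp pE]]]; exists (arc_head f :: p); split=> //=.
  by rewrite pp -surjective_pairing mem_tnth.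
move=> e; rewrite !inE pE; congr (_ || _).
rewrite -surjective_pairing.
apply/eqP/eqP => [|->//] E; exact: (elimT (tuple_uniqP arcs) (st_dag_uniq dag)).
Qed.

Lemma walk_through v : exists r1 r2, walk ord0 r1 v /\ walk v r2 ord_max.
Proof.
have [p [/andP[pp /eqP lp] vp]] := st_dag_cover dag v.
have [p1 [p2 [Ep lv]]] : exists p1 p2, p = p1 ++ p2 /\ last ord0 p1 = v.
  by case/path.splitPl: vp => p1 p2 E; exists p1, p2.
move: pp lp; rewrite Ep cat_path last_cat lv => /andP[/path_walk[r1 [w1 _]] /path_walk[r2 [w2 _]]] l2.
by exists r1, r2; split; [rewrite -lv | rewrite -l2].
Qed.

Lemma in_arc_exists v : v != ord0 -> exists e, arc_head e = v.
Proof.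
have [r [_ [w _]]] := walk_through v.
case/lastP: r w => [/= /eqP <-|r e]; first by rewrite eqxx.
by rewrite walk_rcons => /andP[_ /eqP <-]; exists e.
Qed.

Lemma out_arc_exists v : v != ord_max -> exists e, arc_tail e = v.
Proof.
have [_ [[|e r] [_ /=]]] := walk_through v; first by move=> /eqP->; rewrite eqxx.
by move=> /andP[/eqP <- _]; exists e.
Qed.

(** * Characteristic vectors of walks and the quadratic form *)

Variable R : realType.

(** A sum of unit vectors is additive under concatenation; on walks, which repeat no arc, it is the
    characteristic vector. *)
Definition walk_vec (r : seq 'I_m) : 'cV[R]_m := \sum_(e <- r) delta_mx e 0.

Lemma walk_vecE r e : uniq r -> walk_vec r e 0 = (e \in r)%:R.
Proof.
elim: r => [|f r IH] /=; first by rewrite /walk_vec big_nil mxE.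
move=> /andP[fr /IH]; rewrite /walk_vec big_cons mxE => ->; rewrite mxE inE eqxx andbT.
by case: (eqVneq e f) => [->|_]; rewrite ?(negPf fr) ?addr0 ?add0r.
Qed.

Lemma feasibleP (x : 'cV[R]_m) :
  feasible arcs x <-> exists r, walk ord0 r ord_max /\ x = walk_vec r.
Proof.
split=> [[p [/andP[/path_walk[r [w rE]] /eqP lp] ->]]|[r [w ->]]].
  exists r; rewrite lp in w; split=> //; apply/matrixP => e j.
  by rewrite ord1 walk_vecE ?(walk_uniq w) // mxE rE.
have [p [pp lp pE]] := walk_path w.
exists p; split; first by rewrite /st_path pp lp /=.
by apply/matrixP => e j; rewrite ord1 walk_vecE ?(walk_uniq w) // mxE pE.
Qed.

Variable Q : 'M[R]_m.
Hypothesis Qsym : Q^T = Q.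

Definition qform (x y : 'cV[R]_m) : R := (x^T *m Q *m y) 0 0.

Lemma qformDl x y z : qform (x + y) z = qform x z + qform y z.
Proof. by rewrite /qform linearD /= !mulmxDl mxE. Qed.

Lemma qformDr x y z : qform z (x + y) = qform z x + qform z y.
Proof. by rewrite /qform mulmxDr mxE. Qed.

Lemma qformNl x z : qform (- x) z = - qform x z.
Proof. by rewrite /qform linearN /= !mulNmx mxE. Qed.

Lemma qformNr x z : qform z (- x) = - qform z x.
Proof. by rewrite /qform mulmxN mxE. Qed.

Lemma qformC x y : qform x y = qform y x.
Proof.
have E : (x^T *m Q *m y)^T = y^T *m Q *m x by rewrite !trmx_mul trmxK Qsym mulmxA.
by rewrite /qform -E [RHS]mxE.
Qed.

Lemma qform_suml (I : Type) (s : seq I) F z :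
  qform (\sum_(i <- s) F i) z = \sum_(i <- s) qform (F i) z.
Proof.
elim/big_ind2: _ => [|x a y b <- <-|//]; last by rewrite qformDl.
by rewrite /qform trmx0 !mul0mx mxE.
Qed.

Definition qformE := (qformDl, qformDr, qformNl, qformNr).

(** * Reference walks and the orthogonality criterion *)

Variables A B : 'I_n.+1 -> seq 'I_m.
Hypothesis walkA : forall v, walk ord0 (A v) v.
Hypothesis walkB : forall v, walk v (B v) ord_max.

(** The difference of two walks from [s] to the head of [e]; [out_cycle] compares two walks from the
    tail of [e] to [t]. *)
Definition in_cycle (e : 'I_m) : 'cV[R]_m :=
  delta_mx e 0 + walk_vec (A (arc_tail e)) - walk_vec (A (arc_head e)).
Definition out_cycle (e : 'I_m) : 'cV[R]_m :=
  delta_mx e 0 + walk_vec (B (arc_head e)) - walk_vec (B (arc_tail e)).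

Definition reachable (u v : 'I_n.+1) : Prop := exists r, walk u r v.

Definition cycles_orthogonal : Prop := forall e f,
  reachable (arc_head e) (arc_tail f) -> qform (in_cycle e) (out_cycle f) = 0.

Lemma walk_vec_cat r1 r2 : walk_vec (r1 ++ r2) = walk_vec r1 + walk_vec r2.
Proof. by rewrite /walk_vec big_cat. Qed.

Lemma walk_vec1 e : walk_vec [:: e] = delta_mx e 0.
Proof. by rewrite /walk_vec big_seq1. Qed.

Lemma linearization_vectorP (c : 'cV[R]_m) :
  linearization_vector arcs Q c <->
  forall r, walk ord0 r ord_max ->
    qform (walk_vec r) (walk_vec r) = \sum_(e <- r) c e 0.
Proof.
have E r : (c^T *m walk_vec r) 0 0 = \sum_(e <- r) c e 0.
  rewrite /walk_vec mulmx_sumr summxE; apply: eq_bigr => e _.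
  by rewrite -colE !mxE.
split=> [lin r w|H x /feasibleP[r [w ->]]].
  by rewrite -E /qform lin //; apply/feasibleP; exists r.
by apply/matrixP => i j; rewrite !ord1 E -H.
Qed.

(** In the alternating sum over the four walks all linear costs cancel, whereas the quadratic cost
    leaves twice the product of the two cycles; the middle walk [r] drops out. *)
Lemma linearizable_orthogonal : linearizable arcs Q -> cycles_orthogonal.
Proof.
move=> [c /linearization_vectorP lin] e f [r w].
have step_e : walk ord0 (A (arc_tail e) ++ [:: e]) (arc_head e).
  by apply: walk_cat (walkA _) _; rewrite /= !eqxx.
have step_f : walk (arc_tail f) ([:: f] ++ B (arc_head f)) ord_max.
  by rewrite /= eqxx walkB.
have H1 := lin _ (walk_cat step_e (walk_cat w step_f)).
have H2 := lin _ (walk_cat step_e (walk_cat w (walkB _))).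
have H3 := lin _ (walk_cat (walkA _) (walk_cat w step_f)).
have H4 := lin _ (walk_cat (walkA _) (walk_cat w (walkB _))).
move: H1 H2 H3 H4; rewrite !walk_vec_cat !walk_vec1 !big_cat /= !big_cons.
rewrite !big_nil /in_cycle /out_cycle !qformE.
move: (walk_vec (A _)) (walk_vec (A _)) (walk_vec (B _)) (walk_vec (B _)) (walk_vec r).
move=> a a' b b' y.
move: (delta_mx e 0) (delta_mx f 0) => d d'.
rewrite !(qformC b) !(qformC b') !(qformC d') !(qformC y).
lra.
Qed.

(* The factor is 0 on the arcs out of s: otherwise the sum over an s-t path would
   be off by the cost of [B ord0]. *)
Definition before (e : 'I_m) : 'cV[R]_m :=
  (arc_tail e != ord0)%:R *: (walk_vec (A (arc_tail e)) + walk_vec (B (arc_tail e))).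
Definition after (e : 'I_m) : 'cV[R]_m :=
  walk_vec (A (arc_tail e)) + delta_mx e 0 + walk_vec (B (arc_head e)).

Definition canonical_vec : 'cV[R]_m :=
  \col_e (qform (after e) (after e) - qform (before e) (before e)).

Lemma canonical_linearization :
  cycles_orthogonal -> linearization_vector arcs Q canonical_vec.
Proof.
move=> orth; apply/linearization_vectorP => r0 w0.
have A0 : walk_vec (A ord0) = 0.
  by rewrite (walk_loop (walkA ord0)) /walk_vec big_nil.
have Bt : walk_vec (B ord_max) = 0.
  by rewrite (walk_loop (walkB ord_max)) /walk_vec big_nil.
(* Completing each initial piece by the reference walk from its end turns the partial sums of
   [canonical_vec] into costs of complete walks. *)
suff claim r v : r != [::] -> walk ord0 r v ->
    qform (walk_vec r + walk_vec (B v)) (walk_vec r + walk_vec (B v)) =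
    \sum_(e <- r) canonical_vec e 0.
  have [->|r0n] := eqVneq r0 [::].
    by rewrite /walk_vec !big_nil /qform mulmx0 mxE.
  by have := claim _ _ r0n w0; rewrite Bt addr0.
elim/last_ind: r v => // r e IH v _; rewrite walk_rcons => /andP[w /eqP <-] {v}.
rewrite -cats1 big_cat /= big_seq1 walk_vec_cat walk_vec1.
rewrite mxE /before /after.
(* For the first arc, [before] vanishes and [A ord0] is empty, so [after] is already the whole
   walk. *)
have [Er|rn] := eqVneq r [::].
  rewrite Er /= in w *; rewrite -(eqP w) eqxx scale0r A0 big_nil /walk_vec big_nil.
  rewrite !add0r; set z := delta_mx _ _ + _.
  by rewrite /(qform 0) trmx0 !mul0mx mxE subr0.
have tn : arc_tail e != ord0.
  apply/eqP => te; rewrite te in w.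
  by rewrite (walk_loop w) eqxx in rn.
rewrite tn scale1r -(IH _ rn w).
(* Expanded, this says that replacing [r] by the reference walk does not change the cost increment
   due to [e]. *)
have : qform (walk_vec r - walk_vec (A (arc_tail e))) (out_cycle e) = 0.
  (* The reference walks to intermediate vertices cancel. *)
  have tele u r' v : walk u r' v ->
      walk_vec r' + walk_vec (A u) - walk_vec (A v) = \sum_(g <- r') in_cycle g.
    elim: r' u => [|g r' IH'] u /=; first by move=> /eqP->; rewrite /walk_vec !big_nil add0r subrr.
    move=> /andP[/eqP<- /IH']; rewrite big_cons => <-.
    rewrite /in_cycle -cat1s walk_vec_cat walk_vec1.
    by apply/matrixP => i j; rewrite !mxE; ring.
  have := tele _ _ _ w; rewrite A0 addr0 => ->.
  rewrite qform_suml big_seq big1 // => g gr; apply: orth.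
  exact: walk_reach w gr.
rewrite /out_cycle !qformE.
move: (walk_vec (A _)) (walk_vec (B _)) (walk_vec (B _)) (walk_vec r) (delta_mx e 0).
move=> a b b' y d.
rewrite !(qformC b) !(qformC b') !(qformC d).
lra.
Qed.

End Walks.

(** * Selecting the first arc at a vertex arithmetically *)

Section FirstIndices.
Variables (R : realType) (m : nat) (T : eqType) (h : 'I_m -> T) (C : 'I_m -> R).
Hypothesis CE : forall e, C e = \sum_(k < m) (k < e)%N%:R * (h e == h k)%:R.

(* [C k / C k] is 1 or, when k is the first index with its value, 0 / 0 = 0. *)
Lemma sum_first v : (exists e, h e = v) -> exists2 e, h e = v &
  forall phi : 'I_m -> R,
    \sum_(k < m) (h k == v)%:R * (1 - C k / C k) * phi k = phi e.
Proof.
move=> [e0 /eqP he0].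
(* The count [C] is 0 at the smallest index with value [v] and positive at all later ones, which
   count this index. *)
case: (@arg_minnP _ e0 (fun k => h k == v) (fun k : 'I_m => val k) he0) => e /eqP he emin.
exists e => // phi; rewrite (bigD1 e) //= he eqxx CE big1 => [|k _].
  rewrite mul0r subr0 !mul1r big1 ?addr0 // => k ke.
  have [/eqP hk|] := boolP (h k == v); last by rewrite !mul0r.
  suff: C k != 0 by move=> /divff->; rewrite subrr mulr0 mul0r.
  have ek : (e < k)%N by rewrite ltn_neqAle eq_sym ke emin ?hk.
  rewrite CE gt_eqF // (bigD1 e) //= ek hk he eqxx mulr1 ltr_pwDl //.
  by apply: sumr_ge0 => i _; rewrite mulr_ge0 ?ler0n.
have [ke|] := boolP (k < e)%N; last by rewrite mul0r.
rewrite he mul1r; case: (v =P h k) => // /esym/eqP/emin.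
by rewrite leqNgt ke.
Qed.

End FirstIndices.

(** * Recurrences for reference walks and walk counts *)

Section Tables.
Variables (R : realType) (n m : nat) (arcs : m.-tuple ('I_n.+1 * 'I_n.+1)).
Hypothesis dag : st_dag arcs.
Local Notation hd := (arc_head arcs).
Local Notation tl := (arc_tail arcs).

(** The factor [1 - C e / C e] keeps only the first arc entering [v], so [A v] is the reference walk
    to its tail followed by that arc. Tails precede heads, which makes the recursion well-founded;
    at [s] all terms vanish. *)
Lemma in_walks (C : 'I_m -> R) (X : 'I_n.+1 -> 'I_m -> R) :
  (forall e, C e = \sum_(k < m) (k < e)%N%:R * (hd e == hd k)%:R) ->
  (forall v g, X v g = \sum_(e < m) (hd e == v)%:R * (1 - C e / C e) *
                         ((g == e)%:R + X (tl e) g)) ->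
  exists A, (forall v, walk arcs ord0 (A v) v) /\
            forall v g, X v g = walk_vec R (A v) g 0.
Proof.
move=> CE XE.
suff H v : exists r, walk arcs ord0 r v /\ forall g, X v g = walk_vec R r g 0.
  have [A HA] := fin_all_exists H.
  by exists A; split=> v; have [] := HA v.
have [N] := ubnP (val v); elim: N => // N IH in v *.
rewrite ltnS => vN.
have [-> {v vN}|v0] := eqVneq v ord0.
  exists [::]; split=> // g; rewrite /walk_vec big_nil mxE XE big1 // => e _.
  case: eqP => [h0|_]; last by rewrite !mul0r.
  by have := arc_tail_lt_head dag e; rewrite h0.
have [e he sumE] := sum_first CE (in_arc_exists dag v0).
have [|r [w rE]] := IH (tl e).
  by apply: leq_trans vN; rewrite -he arc_tail_lt_head.
exists (rcons r e); split; first by rewrite walk_rcons w he eqxx.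
move=> g; rewrite XE (sumE (fun e => (g == e)%:R + X (tl e) g)) rE.
by rewrite -cats1 walk_vec_cat walk_vec1 addrC !mxE eqxx andbT.
Qed.

(** Dually, [B v] starts with the first arc leaving [v]; the induction is on [n - v], because heads
    come later. *)
Lemma out_walks (C : 'I_m -> R) (Y : 'I_n.+1 -> 'I_m -> R) :
  (forall e, C e = \sum_(k < m) (k < e)%N%:R * (tl e == tl k)%:R) ->
  (forall v g, Y v g = \sum_(e < m) (tl e == v)%:R * (1 - C e / C e) *
                         ((g == e)%:R + Y (hd e) g)) ->
  exists B, (forall v, walk arcs v (B v) ord_max) /\
            forall v g, Y v g = walk_vec R (B v) g 0.
Proof.
move=> CE YE.
suff H v : exists r, walk arcs v r ord_max /\ forall g, Y v g = walk_vec R r g 0.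
  have [B HB] := fin_all_exists H.
  by exists B; split=> v; have [] := HB v.
have [N] := ubnP (n - v)%N; elim: N => // N IH in v *.
rewrite ltnS => vN.
have [-> {v vN}|v0] := eqVneq v ord_max.
  exists [::]; split=> [|g]; first by rewrite /= eqxx.
  rewrite /walk_vec big_nil mxE YE big1 // => e _.
  case: eqP => [h0|_]; last by rewrite !mul0r.
  by have := arc_tail_lt_head dag e; rewrite h0 ltnNge -ltnS ltn_ord.
have [e te sumE] := sum_first CE (out_arc_exists dag v0).
have [|r [w rE]] := IH (hd e).
  have := arc_tail_lt_head dag e; have := ltn_ord (hd e); rewrite te; lia.
exists (e :: r); split; first by rewrite /= te eqxx.
move=> g; rewrite YE (sumE (fun e => (g == e)%:R + Y (hd e) g)) rE.
by rewrite -cat1s walk_vec_cat walk_vec1 !mxE eqxx andbT.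
Qed.

(* M v g counts the walks that start with the arc g and end in v. *)
Lemma walk_count (M : 'I_n.+1 -> 'I_m -> R) :
  (forall v g, M v g = \sum_(e < m) (hd e == v)%:R * ((g == e)%:R + M (tl e) g)) ->
  forall v g, 0 <= M v g /\ (M v g <> 0 <-> reachable arcs (hd g) v).
Proof.
move=> ME.
have ge0 v g : 0 <= M v g.
  have [N] := ubnP (val v); elim: N => // N IH in v *; rewrite ltnS => vN.
  rewrite ME sumr_ge0 // => e _.
  case: eqP => [he|_]; last by rewrite mul0r.
  rewrite mul1r addr_ge0 // IH //.
  by apply: leq_trans vN; rewrite -he arc_tail_lt_head.
move=> v g; split=> //; split.
  have [N] := ubnP (val v); elim: N => // N IH in v *; rewrite ltnS => vN.
  (* A nonzero sum of nonnegative terms has a nonzero term, whose arc ends the walk to be found. *)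
  rewrite ME => /eqP; rewrite psumr_neq0 => [/hasP[e _]|e _]; last first.
    by rewrite mulr_ge0 ?addr_ge0.
  move=> /= /lt0r_neq0; rewrite mulf_eq0 negb_or => /andP[].
  case: (hd e =P v) => [he _|_]; last by rewrite mulr0n eqxx.
  have [->|ge] := eqVneq g e; first by exists [::]; rewrite /= he.
  rewrite add0r => /eqP/IH[|r w].
    by apply: leq_trans vN; rewrite -he arc_tail_lt_head.
  by exists (rcons r e); rewrite walk_rcons w he eqxx.
move=> [r w]; apply/eqP; rewrite gt_eqF //.
(* Conversely, each further arc of the walk passes positivity on to its head. *)
elim/last_ind: r v w => [|r e IH] v.
  move=> /= /eqP <-; rewrite ME (bigD1 g) //= !eqxx mul1r -addrA ltr_pwDl //.
  by rewrite addr_ge0 // sumr_ge0 // => i _; rewrite mulr_ge0 ?addr_ge0.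
rewrite walk_rcons => /andP[/IH Mpos /eqP <-].
rewrite ME (bigD1 e) //= eqxx mul1r ltr_wpDr //.
  by rewrite sumr_ge0 // => i _; rewrite mulr_ge0 ?addr_ge0.
by rewrite ltr_wpDl.
Qed.

(** Squares with nonnegative weights have a nonpositive sum only if every term vanishes, so one
    comparison tests all reachable pairs at once. *)
Lemma defect_eq0 (Q : 'M[R]_m) A B (M : 'I_n.+1 -> 'I_m -> R) :
  (forall v g, 0 <= M v g /\ (M v g <> 0 <-> reachable arcs (hd g) v)) ->
  let H e f := qform Q (in_cycle arcs R A e) (out_cycle arcs R B f) in
  (\sum_(e < m) \sum_(f < m) M (tl f) e * (H e f * H e f) <= 0) <->
  cycles_orthogonal arcs Q A B.
Proof.
move=> MP H.
have ge0 e f : 0 <= M (tl f) e * (H e f * H e f).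
  by rewrite mulr_ge0 ?(proj1 (MP _ _)) // -expr2 sqr_ge0.
split=> [le0 e f /(proj2 (MP _ _)) Mn0|orth].
  have : \sum_(e < m) \sum_(f < m) M (tl f) e * (H e f * H e f) == 0.
    by rewrite eq_le le0 !sumr_ge0 // => *; rewrite sumr_ge0.
  rewrite psumr_eq0 => [/allP/(_ e (mem_index_enum _))/=|*]; last by rewrite sumr_ge0.
  rewrite psumr_eq0 // => /allP/(_ f (mem_index_enum _))/=.
  by rewrite !mulf_eq0 orbb => /orP[/eqP//|/eqP].
rewrite big1 // => e _; rewrite big1 // => f _.
have [->|/eqP Mn0] := eqVneq (M (tl f) e) 0; first by rewrite mul0r.
by rewrite /H orth ?mul0r ?mulr0 //; apply/(proj2 (MP _ _)).
Qed.

End Tables.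

(** * The program *)

Definition cur_row := cell0 5.
Definition cur_col := cell0 6.
Definition cur_term := cell0 7.
Definition vertices := cell0 0.
Definition num_arcs := cell0 1.
Definition tail_of (e : nexp) := NGet 2 e (NConst 0).
Definition head_of (e : nexp) := NGet 3 e (NConst 0).
(* Vertex v is numbered n - v when the vertices are processed in reverse order. *)
Definition opposite (v : nexp) := NSub vertices (NAdd v (NConst 1)).
Definition get0 (t : nat) (x : nexp) := RGet t x (NConst 0).

(* Array 2 of reals holds 1 in cell (0, 0) and 0 elsewhere, which turns conditions
   on indices into real numbers. *)
Definition zero_ind (x : nexp) := RGet 2 x (NConst 0).
(** With truncated subtraction, [x + 1 - y] is 0 exactly if [x < y], and in [eq_ind] both
    differences are 0 exactly if [x = y]. *)
Definition lt_ind (x y : nexp) := zero_ind (NSub (NAdd x (NConst 1)) y).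
Definition eq_ind (x y : nexp) := zero_ind (NAdd (NSub x y) (NSub y x)).
(* With array t counting the earlier arcs that have the same head (or tail), this
   is 1 for the first such arc and 0 for the others, because 0 / 0 = 0. *)
Definition first_ind (t : nat) :=
  RSub (RConst 1) (RDiv (get0 t cur_term) (get0 t cur_term)).

Definition out_vec (v : nexp) := RGet 6 (opposite v).
Definition after_exp (e g : nexp) :=
  RAdd (RAdd (RGet 5 (tail_of e) g) (eq_ind g e)) (out_vec (head_of e) g).
Definition before_exp (e g : nexp) :=
  RMul (RSub (RConst 1) (zero_ind (tail_of e)))
    (RAdd (RGet 5 (tail_of e) g) (out_vec (tail_of e) g)).

Definition earlier_in_term :=
  RMul (lt_ind cur_term cur_row) (eq_ind (head_of cur_row) (head_of cur_term)).
Definition earlier_out_term :=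
  RMul (lt_ind cur_term cur_row) (eq_ind (tail_of cur_row) (tail_of cur_term)).
(** The recurrence of [in_walks]: array 5 is read at the row of a tail while it is being filled. *)
Definition in_term :=
  RMul (RMul (eq_ind (head_of cur_term) cur_row) (first_ind 3))
    (RAdd (eq_ind cur_col cur_term) (RGet 5 (tail_of cur_term) cur_col)).
Definition out_term :=
  RMul (RMul (eq_ind (tail_of cur_term) (opposite cur_row)) (first_ind 4))
    (RAdd (eq_ind cur_col cur_term) (out_vec (head_of cur_term) cur_col)).
Definition reach_term :=
  RMul (eq_ind (head_of cur_term) cur_row)
    (RAdd (eq_ind cur_col cur_term) (RGet 7 (tail_of cur_term) cur_col)).
Definition in_cost_term := RMul (RGet 5 cur_row cur_term) (RGet 0 cur_term cur_col).
(** The first factor is a coordinate of [in_cycle] multiplied by [Q], the second a coordinate of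
    [out_cycle]. The products with [Q] stored in array 8 make a single sum per pair of arcs
    suffice. *)
Definition cross_term :=
  RMul (RSub (RAdd (RGet 0 cur_row cur_term) (RGet 8 (tail_of cur_row) cur_term))
             (RGet 8 (head_of cur_row) cur_term))
    (RSub (RAdd (eq_ind cur_term cur_col) (out_vec (head_of cur_col) cur_term))
          (out_vec (tail_of cur_col) cur_term)).
Definition defect_term :=
  RMul (RGet 7 (tail_of cur_term) cur_row) (RMul (RGet 9 cur_row cur_term) (RGet 9 cur_row cur_term)).
Definition total_term := get0 10 cur_term.
(** For the vectors [a] of [after] and [b] of [before], symmetry of [Q] gives
    [a^T Q a - b^T Q b = (a + b)^T Q (a - b)]. Array 12 holds the rows [(a + b)^T Q], and
    [vector_term] multiplies by [a - b]. *)
Definition cost_term :=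
  RMul (RAdd (after_exp cur_row cur_term) (before_exp cur_row cur_term)) (RGet 0 cur_term cur_col).
Definition vector_term :=
  RMul (RGet 12 cur_row cur_term) (RSub (after_exp cur_row cur_term) (before_exp cur_row cur_term)).

(* Arrays of reals: 5 and 6 hold the characteristic vectors of the A_v and of the
   B_v (reversed), 7 the numbers of paths, 8 the A_v^T Q, 9 the H(e,g). *)
Definition algorithm : cmd :=
  Seq (RSet 2 (NConst 0) (NConst 0) (RConst 1))
  (Seq (table 3 num_arcs (NConst 1) num_arcs earlier_in_term)
  (Seq (table 4 num_arcs (NConst 1) num_arcs earlier_out_term)
  (Seq (table 5 vertices num_arcs num_arcs in_term)
  (Seq (table 6 vertices num_arcs num_arcs out_term)
  (Seq (table 7 vertices num_arcs num_arcs reach_term)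
  (Seq (table 8 vertices num_arcs num_arcs in_cost_term)
  (Seq (table 9 num_arcs num_arcs num_arcs cross_term)
  (Seq (table 10 num_arcs (NConst 1) num_arcs defect_term)
  (Seq (table 11 (NConst 1) (NConst 1) num_arcs total_term)
  (Seq (table 12 num_arcs num_arcs num_arcs cost_term)
  (Seq (table 1 num_arcs (NConst 1) num_arcs vector_term)
    (If (BRLe (get0 11 (NConst 0)) (RConst 0))
       (NSet 4 (NConst 0) (NConst 0) (NConst 1)) Skip)))))))))))).

(** * Evaluation of the program's expressions *)

Section Run.
Variable R : realType.
Variables (n m : nat) (arcs : m.-tuple ('I_n.+1 * 'I_n.+1)) (Q : 'M[R]_m).
Hypothesis dag : st_dag arcs.

Let nm := nmem (input_state arcs Q).
Let rm0 := set_array (rmem (input_state arcs Q)) 2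
  (fun i j => ((i == 0%N) && (j == 0%N))%:R).

(** These rules unfold one constructor at a time; simplification would also open the indicators,
    which [indE] evaluates as a whole. *)
Definition revalE := (
  (fun (st : state R) a x y => erefl : reval st (RGet a x y) = rmem st a (neval st x) (neval st y)),
  (fun (st : state R) k => erefl : reval st (RConst k) = k%:R),
  (fun (st : state R) x y => erefl : reval st (RAdd x y) = reval st x + reval st y),
  (fun (st : state R) x y => erefl : reval st (RSub x y) = reval st x - reval st y),
  (fun (st : state R) x y => erefl : reval st (RMul x y) = reval st x * reval st y),
  (fun (st : state R) x y => erefl : reval st (RDiv x y) = reval st x / reval st y)).

Section Eval.
Variables (rm : memory R) (i j k : nat).
Let st := counters nm rm i j k.

Lemma neval_row : neval st cur_row = i. Proof. by []. Qed.
Lemma neval_col : neval st cur_col = j. Proof. by []. Qed.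
Lemma neval_term : neval st cur_term = k. Proof. by []. Qed.
Lemma neval_const c : neval st (NConst c) = c. Proof. by []. Qed.

Lemma neval_opposite x : neval st (opposite x) = (n - neval st x)%N.
Proof. by rewrite /= addn1 subSS. Qed.

Lemma neval_tail_of x : neval st (tail_of x) = nth 0%N [seq val uv.1 | uv <- arcs] (neval st x).
Proof. by []. Qed.

Lemma neval_head_of x : neval st (head_of x) = nth 0%N [seq val uv.2 | uv <- arcs] (neval st x).
Proof. by []. Qed.

Definition nevalE := (neval_row, neval_col, neval_term, neval_const, neval_opposite,
  neval_tail_of, neval_head_of).

Hypothesis rm2 : rm 2 = fun a b => ((a == 0%N) && (b == 0%N))%:R.

Lemma reval_zero_ind x : reval st (zero_ind x) = (neval st x == 0%N)%:R.
Proof. by rewrite /= rm2 andbT. Qed.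

Lemma reval_lt_ind x y : reval st (lt_ind x y) = (neval st x < neval st y)%N%:R.
Proof. by rewrite reval_zero_ind /= addn1 subn_eq0. Qed.

Lemma reval_eq_ind x y : reval st (eq_ind x y) = (neval st x == neval st y)%:R.
Proof. by rewrite reval_zero_ind /= addn_eq0 !subn_eq0 -eqn_leq. Qed.

Definition indE := (reval_eq_ind, reval_lt_ind, reval_zero_ind).
End Eval.

Lemma nth_tail (e : 'I_m) : nth 0%N [seq val uv.1 | uv <- arcs] e = arc_tail arcs e.
Proof. by rewrite (nth_map (tnth arcs e)) ?size_tuple // -tnth_nth. Qed.

Lemma nth_head (e : 'I_m) : nth 0%N [seq val uv.2 | uv <- arcs] e = arc_head arcs e.
Proof. by rewrite (nth_map (tnth arcs e)) ?size_tuple // -tnth_nth. Qed.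

(** A common bound for the loop sizes of all tables; the factor 4 absorbs [n.+2] against [n.+1] and
    the dimensions equal to 1. *)
Let budget := (4 * (n.+1 * m.+1 ^ 3))%N.

(** All other real arrays are those of [rm], so facts about earlier tables survive. *)
Definition holds_table (t : nat) (rm : memory R) (P : (nat -> nat -> R) -> Prop)
    (st : state R) : Prop :=
  exists i j k T, st = counters nm (set_array rm t T) i j k /\ P T.

Lemma run_table t rows cols terms e N M K rm i0 j0 k0 P :
  (forall (rm : memory R) i j k, neval (counters nm rm i j k) rows = N) ->
  (forall (rm : memory R) i j k, neval (counters nm rm i j k) cols = M) ->
  (forall (rm : memory R) i j k, neval (counters nm rm i j k) terms = K) ->
  (N.+1 * M.+1 * K.+1 <= budget)%N ->
  (forall T T' i j k, (i < N)%N -> (j < M)%N -> (k < K)%N ->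
     (forall i' j', (i' < i)%N -> (j' < M)%N -> T i' j' = T' i' j') ->
     reval (counters nm (set_array rm t T) i j k) e =
     reval (counters nm (set_array rm t T') i j k) e) ->
  (forall T : nat -> nat -> R, (forall (i : 'I_N) (j : 'I_M),
     T i j = \sum_(k < K) reval (counters nm (set_array rm t T) i j k) e) -> P T) ->
  halts (table t rows cols terms e) (counters nm rm i0 j0 k0)
    (table_cost rows cols terms e * budget) (holds_table t rm P).
Proof.
move=> eN eM eK le loc TP.
have [k [st [ex lk [i [j [k' [T [E ET]]]]]]]] :=
  table_halts i0 j0 k0 eN eM eK loc.
exists k, st; split=> //; first by apply: leq_trans lk _; rewrite leq_mul2l le orbT.
by exists i, j, k', T; split=> //; apply: TP => i' j'; apply: ET.
Qed.

(** * Correctness of the individual tables *)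

Section Tables.
Variables (rm : memory R) (i0 j0 k0 : nat).
Hypothesis rm2 : rm 2 = fun a b => ((a == 0%N) && (b == 0%N))%:R.
Let st0 := counters nm rm i0 j0 k0.

Local Notation hd := (arc_head arcs).
Local Notation tl := (arc_tail arcs).

Lemma budget_bounds : [/\ (n.+2 * m.+1 * m.+1 <= budget)%N, (m.+1 * m.+1 * m.+1 <= budget)%N,
  (m.+1 * 2 * m.+1 <= budget)%N & (2 * 2 * m.+1 <= budget)%N].
Proof. rewrite /budget !expnS expn0; split; nia. Qed.

Lemma run_earlier_in :
  halts (table 3 num_arcs (NConst 1) num_arcs earlier_in_term) st0
    (table_cost num_arcs (NConst 1) num_arcs earlier_in_term * budget)
    (holds_table 3 rm (fun T => forall e : 'I_m,
       T e 0%N = \sum_(k < m) (k < e)%N%:R * (hd e == hd k)%:R)).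
Proof.
have [_ _ le _] := budget_bounds.
apply: (run_table (N := m) (M := 1) (K := m)) => // T E e.
rewrite (E e ord0); apply: eq_bigr => k _.
by rewrite /earlier_in_term !(indE, revalE) // !nevalE !nth_head.
Qed.

Lemma run_earlier_out :
  halts (table 4 num_arcs (NConst 1) num_arcs earlier_out_term) st0
    (table_cost num_arcs (NConst 1) num_arcs earlier_out_term * budget)
    (holds_table 4 rm (fun T => forall e : 'I_m,
       T e 0%N = \sum_(k < m) (k < e)%N%:R * (tl e == tl k)%:R)).
Proof.
have [_ _ le _] := budget_bounds.
apply: (run_table (N := m) (M := 1) (K := m)) => // T E e.
rewrite (E e ord0); apply: eq_bigr => k _.
by rewrite /earlier_out_term !(indE, revalE) // !nevalE !nth_tail.
Qed.

Lemma run_in :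
  (forall e : 'I_m, rm 3 e 0%N = \sum_(k < m) (k < e)%N%:R * (hd e == hd k)%:R) ->
  halts (table 5 vertices num_arcs num_arcs in_term) st0
    (table_cost vertices num_arcs num_arcs in_term * budget)
    (holds_table 5 rm (fun T => exists A, (forall v, walk arcs ord0 (A v) v) /\
       forall (v : 'I_n.+1) (g : 'I_m), T v g = walk_vec R (A v) g 0)).
Proof.
move=> H3; have [le _ _ _] := budget_bounds.
apply: (run_table (N := n.+1) (M := m) (K := m)) => // [T T' i j k iN jM kK TT'|T E].
  rewrite /in_term /first_ind /get0 !(indE, revalE) // !nevalE.
  rewrite (nth_head (Ordinal kK)) (nth_tail (Ordinal kK)) /set_array /=.
  (* Only arcs into vertex [i] contribute, and their tails index earlier rows. *)
  case: eqP => [hi|_]; last by rewrite !mul0r.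
  by rewrite TT' // -hi arc_tail_lt_head.
apply: (in_walks dag H3) => v g; rewrite E; apply: eq_bigr => e _.
by rewrite /in_term /first_ind /get0 !(indE, revalE) // !nevalE nth_head nth_tail.
Qed.

Lemma run_out :
  (forall e : 'I_m, rm 4 e 0%N = \sum_(k < m) (k < e)%N%:R * (tl e == tl k)%:R) ->
  halts (table 6 vertices num_arcs num_arcs out_term) st0
    (table_cost vertices num_arcs num_arcs out_term * budget)
    (holds_table 6 rm (fun T => exists B, (forall v, walk arcs v (B v) ord_max) /\
       forall (v : 'I_n.+1) (g : 'I_m), T (n - v)%N g = walk_vec R (B v) g 0)).
Proof.
move=> H4; have [le _ _ _] := budget_bounds.
apply: (run_table (N := n.+1) (M := m) (K := m)) => // [T T' i j k iN jM kK TT'|T E].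
  rewrite /out_term /first_ind /get0 /out_vec !(indE, revalE) // !nevalE.
  rewrite (nth_head (Ordinal kK)) (nth_tail (Ordinal kK)) /set_array /=.
  (* Vertex [v] has row [n - v], so here heads come before tails. *)
  case: eqP => [hi|_]; last by rewrite !mul0r.
  rewrite TT' //; have := arc_tail_lt_head dag (Ordinal kK).
  by have := ltn_ord (hd (Ordinal kK)); lia.
apply: (out_walks dag H4 (Y := fun v g => T (n - v)%N g)) => v g.
have vn : (n - v < n.+1)%N by lia.
rewrite (E (Ordinal vn) g); apply: eq_bigr => e _.
rewrite /out_term /first_ind /get0 /out_vec !(indE, revalE) // !nevalE nth_head nth_tail /=.
by rewrite subKn // -ltnS.
Qed.

Lemma run_reach :
  halts (table 7 vertices num_arcs num_arcs reach_term) st0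
    (table_cost vertices num_arcs num_arcs reach_term * budget)
    (holds_table 7 rm (fun T => forall (v : 'I_n.+1) (g : 'I_m),
       0 <= T v g /\ (T v g <> 0 <-> reachable arcs (hd g) v))).
Proof.
have [le _ _ _] := budget_bounds.
apply: (run_table (N := n.+1) (M := m) (K := m)) => // [T T' i j k iN jM kK TT'|T E].
  rewrite /reach_term !(indE, revalE) // !nevalE.
  rewrite (nth_head (Ordinal kK)) (nth_tail (Ordinal kK)) /set_array /=.
  case: eqP => [hi|_]; last by rewrite !mul0r.
  by rewrite TT' // -hi arc_tail_lt_head.
apply: (walk_count dag (M := fun v g => T v g)) => v g.
rewrite E; apply: eq_bigr => e _.
by rewrite /reach_term !(indE, revalE) // !nevalE nth_head nth_tail.
Qed.

Variables A B : 'I_n.+1 -> seq 'I_m.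
Hypothesis rm0E : forall g h : 'I_m, rm 0 g h = Q g h.
Hypothesis rm5E : forall (v : 'I_n.+1) (g : 'I_m), rm 5 v g = walk_vec R (A v) g 0.
Hypothesis rm6E : forall (v : 'I_n.+1) (g : 'I_m), rm 6 (n - v)%N g = walk_vec R (B v) g 0.

Lemma run_in_cost :
  halts (table 8 vertices num_arcs num_arcs in_cost_term) st0
    (table_cost vertices num_arcs num_arcs in_cost_term * budget)
    (holds_table 8 rm (fun T => forall (v : 'I_n.+1) (g : 'I_m),
       T v g = ((walk_vec R (A v))^T *m Q) 0 g)).
Proof.
have [le _ _ _] := budget_bounds.
apply: (run_table (N := n.+1) (M := m) (K := m)) => // T E v g.
rewrite E mxE; apply: eq_bigr => h _.
by rewrite /in_cost_term !revalE !nevalE mxE /set_array /= rm5E rm0E.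
Qed.

Lemma run_cross :
  (forall (v : 'I_n.+1) (g : 'I_m), rm 8 v g = ((walk_vec R (A v))^T *m Q) 0 g) ->
  halts (table 9 num_arcs num_arcs num_arcs cross_term) st0
    (table_cost num_arcs num_arcs num_arcs cross_term * budget)
    (holds_table 9 rm (fun T => forall e f : 'I_m,
       T e f = qform Q (in_cycle arcs R A e) (out_cycle arcs R B f))).
Proof.
move=> H8; have [_ le _ _] := budget_bounds.
apply: (run_table (N := m) (M := m) (K := m)) => // T E e f.
rewrite E /qform mxE; apply: eq_bigr => g _.
rewrite /cross_term /out_vec !(indE, revalE) // !nevalE !nth_tail !nth_head /set_array /=.
rewrite rm0E !H8 !rm6E; congr (_ * _); last by rewrite !mxE eqxx andbT.
have -> : (in_cycle arcs R A e)^T = delta_mx 0 e +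
    (walk_vec R (A (tl e)))^T - (walk_vec R (A (hd e)))^T.
  by rewrite -trmx_delta; apply/matrixP => i j; rewrite !mxE.
by rewrite mulmxBl mulmxDl -rowE [RHS]mxE [X in _ = X + _]mxE [row _ _ _ _]mxE [X in _ = _ + X]mxE.
Qed.

Lemma run_defect H :
  (forall e f : 'I_m, rm 9 e f = H e f) ->
  halts (table 10 num_arcs (NConst 1) num_arcs defect_term) st0
    (table_cost num_arcs (NConst 1) num_arcs defect_term * budget)
    (holds_table 10 rm (fun T => forall e : 'I_m,
       T e 0%N = \sum_(f < m) rm 7 (tl f) e * (H e f * H e f))).
Proof.
move=> H9; have [_ _ le _] := budget_bounds.
apply: (run_table (N := m) (M := 1) (K := m)) => // T E e.
rewrite (E e ord0); apply: eq_bigr => f _.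
by rewrite /defect_term !revalE !nevalE nth_tail /set_array /= H9.
Qed.

Lemma run_total :
  halts (table 11 (NConst 1) (NConst 1) num_arcs total_term) st0
    (table_cost (NConst 1) (NConst 1) num_arcs total_term * budget)
    (holds_table 11 rm (fun T => T 0%N 0%N = \sum_(e < m) rm 10 e 0%N)).
Proof.
have [_ _ _ le] := budget_bounds.
by apply: (run_table (N := 1) (M := 1) (K := m)) => // T /(_ ord0 ord0).
Qed.

Lemma reval_after T t e g i j k (e' g' : 'I_m) :
  let st := counters nm (set_array rm t T) i j k in
  t \notin [:: 2; 5; 6]%N -> neval st e = e' -> neval st g = g' ->
  reval st (after_exp e g) = after arcs R A B e' g' 0.
Proof.
move=> st; rewrite !inE !negb_or => /and3P[t2 t5 t6] ee eg.
rewrite /after_exp /out_vec !(indE, revalE) //; last by rewrite /set_array eq_sym (negPf t2).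
rewrite !nevalE ee eg nth_tail nth_head /st /= /set_array !(eq_sym _ t).
by rewrite (negPf t5) (negPf t6) rm5E rm6E !mxE eqxx andbT.
Qed.

Lemma reval_before T t e g i j k (e' g' : 'I_m) :
  let st := counters nm (set_array rm t T) i j k in
  t \notin [:: 2; 5; 6]%N -> neval st e = e' -> neval st g = g' ->
  reval st (before_exp e g) = before arcs R A B e' g' 0.
Proof.
move=> st; rewrite !inE !negb_or => /and3P[t2 t5 t6] ee eg.
rewrite /before_exp /out_vec !(indE, revalE) //; last by rewrite /set_array eq_sym (negPf t2).
rewrite !nevalE ee eg nth_tail /st /= /set_array !(eq_sym _ t).
rewrite (negPf t5) (negPf t6) rm5E rm6E !mxE; congr (_ * _).
by rewrite -val_eqE /=; case: eqP => _; rewrite ?subrr ?subr0.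
Qed.

Lemma run_cost :
  halts (table 12 num_arcs num_arcs num_arcs cost_term) st0
    (table_cost num_arcs num_arcs num_arcs cost_term * budget)
    (holds_table 12 rm (fun T => forall e g : 'I_m,
       T e g = ((after arcs R A B e + before arcs R A B e)^T *m Q) 0 g)).
Proof.
have [_ le _ _] := budget_bounds.
apply: (run_table (N := m) (M := m) (K := m)) => // T E e g.
rewrite E mxE; apply: eq_bigr => h _; rewrite /cost_term.
rewrite !(@reval_after _ _ _ _ _ _ _ e h, @reval_before _ _ _ _ _ _ _ e h, revalE) //.
by rewrite !nevalE /set_array /= rm0E !mxE.
Qed.

Lemma run_vector : Q^T = Q ->
  (forall e g : 'I_m, rm 12 e g =
     ((after arcs R A B e + before arcs R A B e)^T *m Q) 0 g) ->
  halts (table 1 num_arcs (NConst 1) num_arcs vector_term) st0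
    (table_cost num_arcs (NConst 1) num_arcs vector_term * budget)
    (holds_table 1 rm (fun T => forall e : 'I_m,
       T e 0%N = canonical_vec arcs Q A B e 0)).
Proof.
move=> Qsym H12; have [_ _ le _] := budget_bounds.
apply: (run_table (N := m) (M := 1) (K := m)) => // T E e.
set a := after arcs R A B e; set b := before arcs R A B e.
transitivity (qform Q (a + b) (a - b)); last first.
  rewrite [RHS]mxE -/a -/b; clearbody a b.
  rewrite !qformDl !qformDr !qformNr (qformC Qsym b a).
  by ring.
rewrite (E e ord0) /qform mxE; apply: eq_bigr => h _; rewrite /vector_term.
rewrite !(@reval_after _ _ _ _ _ _ _ e h, @reval_before _ _ _ _ _ _ _ e h, revalE) //.
by rewrite !nevalE /set_array /= H12; congr (_ * _); rewrite !mxE.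
Qed.

End Tables.


(** * Running time and correctness of the whole program *)

Definition algorithm_cost : nat :=
  (table_cost num_arcs (NConst 1) num_arcs earlier_in_term +
   table_cost num_arcs (NConst 1) num_arcs earlier_out_term +
   table_cost vertices num_arcs num_arcs in_term +
   table_cost vertices num_arcs num_arcs out_term +
   table_cost vertices num_arcs num_arcs reach_term +
   table_cost vertices num_arcs num_arcs in_cost_term +
   table_cost num_arcs num_arcs num_arcs cross_term +
   table_cost num_arcs (NConst 1) num_arcs defect_term +
   table_cost (NConst 1) (NConst 1) num_arcs total_term +
   table_cost num_arcs num_arcs num_arcs cost_term +
   table_cost num_arcs (NConst 1) num_arcs vector_term + 20)%N.

Lemma init_halts :
  halts (RSet 2 (NConst 0) (NConst 0) (RConst 1)) (input_state arcs Q) 4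
    (eq (counters nm rm0 0 0 0)).
Proof.
exists 4%N, (State nm (upd (rmem (input_state arcs Q)) 2 0 0 1)); split=> //.
  exact: ExecRSet.
rewrite /counters; congr State.
  apply/funext=> a; apply/funext=> i; apply/funext=> j; rewrite /upd.
  (* The three loop counters are already 0 in the input. *)
  by do 3 (case: ifP => [/and3P[/eqP-> _ _] //|_]).
apply/funext=> a; apply/funext=> i; apply/funext=> j; rewrite /rm0 /set_array /upd.
case: (eqVneq a 2) => [->|//] /=.
by case: (_ && _).
Qed.

Lemma algorithm_halts : Q^T = Q ->
  halts algorithm (input_state arcs Q) (algorithm_cost * budget) (fun st =>
    exists A B,
    [/\ forall v, walk arcs ord0 (A v) v, forall v, walk arcs v (B v) ord_max,
        output_vector m st = canonical_vec arcs Q A B &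
        if output_answer st == 1%N then cycles_orthogonal arcs Q A B
        else output_answer st = 0%N /\ ~ cycles_orthogonal arcs Q A B]).
Proof.
move=> Qsym.
have Q0 (g h : 'I_m) : rmem (input_state arcs Q) 0 g h = Q g h by rewrite /= !valK.
(* Initialization takes 4 steps and the final test at most 16. The table lemmas supply the other
   summands, so the comparison with the total is postponed. *)
apply: (halts_weaken (b := (4 + (_ + (_ + (_ + (_ + (_ + (_ + (_ + (_ + (_ + (_ + (_ + 16))))))))))))%N)); first last.
- move=> st; exact.
- shelve.
apply: halts_seq init_halts _ => _ <-.
have D : rm0 2 = fun a b => ((a == 0%N) && (b == 0%N))%:R by [].
apply: halts_seq (run_earlier_in _ _ _ D) _ => _ [i3 [j3 [k3 [T3 [-> E3]]]]].
apply: halts_seq (run_earlier_out _ _ _ _) _ => // _ [i4 [j4 [k4 [T4 [-> E4]]]]].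
apply: halts_seq (run_in _ _ _ _ _) _ => // _ [i5 [j5 [k5 [T5 [-> [A [wA E5]]]]]]].
apply: halts_seq (run_out _ _ _ _ _) _ => // _ [i6 [j6 [k6 [T6 [-> [B [wB E6]]]]]]].
apply: halts_seq (run_reach _ _ _ _) _ => // _ [i7 [j7 [k7 [T7 [-> E7]]]]].
apply: halts_seq (run_in_cost _ _ _ (A := A) _ _) _ => // _ [i8 [j8 [k8 [T8 [-> E8]]]]].
apply: halts_seq (run_cross _ _ _ _ (A := A) (B := B) _ _ _) _ => //
  _ [i9 [j9 [k9 [T9 [-> E9]]]]].
apply: halts_seq (run_defect _ _ _ (H := fun e f => qform Q (in_cycle arcs R A e) (out_cycle arcs R B f)) _) _ => //
  _ [i10 [j10 [k10 [T10 [-> E10]]]]].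
apply: halts_seq (run_total _ _ _ _) _ => _ [i11 [j11 [k11 [T11 [-> E11]]]]].
apply: halts_seq (run_cost _ _ _ _ (A := A) (B := B) _ _ _) _ => //
  _ [i12 [j12 [k12 [T12 [-> E12]]]]].
apply: halts_seq (run_vector _ _ _ _ (A := A) (B := B) _ _ _ _) _ => //
  _ [i13 [j13 [k13 [c [-> Ec]]]]].
have orth : (T11 0%N 0%N <= 0) <-> cycles_orthogonal arcs Q A B.
  rewrite E11 -(defect_eq0 Q A B (M := fun v e => T7 v e) E7).
  by under eq_bigr do rewrite /set_array /= E10.
set st := counters _ _ _ _ _.
have vecE st' : rmem st' = rmem st -> output_vector m st' = canonical_vec arcs Q A B.
  by move=> E; apply/matrixP => e j; rewrite ord1 mxE E -Ec.
case: (boolP (T11 0%N 0%N <= 0)) => T11E.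
- exists 10%N, (set_cell0 4 st 1); split=> //.
    have H := @ExecIf R (BRLe (get0 11 (NConst 0)) (RConst 0))
      (NSet 4 (NConst 0) (NConst 0) (NConst 1)) Skip st (set_cell0 4 st 1) 4.
    apply: H; rewrite /= T11E; exact: ExecNSet.
  by exists A, B; split=> //; [exact: vecE | apply/orth].
(* The answer cell keeps its initial value 0. *)
- exists 7%N, st; split=> //.
    have H := @ExecIf R (BRLe (get0 11 (NConst 0)) (RConst 0))
      (NSet 4 (NConst 0) (NConst 0) (NConst 1)) Skip st st 1.
    apply: H; rewrite /= (negPf T11E); exact: ExecSkip.
  by exists A, B; split=> //; [exact: vecE | split=> // /orth; apply/negP].
Unshelve.
(* A positive budget lets the constant 20 of [algorithm_cost] pay for the 4 and the 16 steps. *)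
have budget_gt0 : (0 < budget)%N by rewrite /budget muln_gt0 /= muln_gt0 /= expn_gt0.
rewrite /algorithm_cost; clear -budget_gt0.
nia.
Qed.

End Run.

Theorem mainTheorem5 (R : realType) :
  exists (algo : cmd) (C : nat),
    forall (n m : nat) (arcs : m.-tuple ('I_n.+1 * 'I_n.+1)) (Q : 'M[R]_m),
      st_dag arcs -> cost_matrix Q ->
      exists (steps : nat) (final : state R),
        [/\ exec algo (input_state arcs Q) steps final,
            (0 < m)%N -> (steps <= C * (n.+1 * m ^ 3))%N,
            linearizable arcs Q -> output_answer final = 1%N /\
              linearization_vector arcs Q (output_vector m final)
          & ~ linearizable arcs Q -> output_answer final = 0%N].
Proof.
(* For positive [m], [m + 1 <= 2 m] bounds [4 (n + 1) (m + 1)^3] by [32 (n + 1) m^3]. *)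
exists algorithm, (algorithm_cost * 32)%N => n m arcs Q dag [Qsym _].
have [k [st [ex lk [A [B [wA wB outE ans]]]]]] := algorithm_halts dag Qsym.
exists k, st; split=> // [m0|lin|nlin].
- apply: leq_trans lk _; rewrite -mulnA leq_mul2l; apply/orP; right.
  rewrite mulnCA [X in (_ <= X)%N]mulnCA leq_mul2l; apply/orP; right.
  rewrite !expnS expn0; clear -m0; nia.
- have orth := linearizable_orthogonal dag Qsym wA wB lin.
  split; last by rewrite outE; exact: canonical_linearization.
  by move: ans; case: eqP => // _ [].
(* A positive answer would make [canonical_vec] a linearization vector. *)
- move: ans; case: eqP => [_ orth|_ []//]; case: nlin.
  by eexists; apply: (canonical_linearization dag Qsym wA wB orth).
Qed.
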